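(* (1) Let $s\in\{+1,-1\}$. No map $q\in\mathcal L_{2,s}$ (bimodal case, $l=2$) with $\mathrm{h}_{\mathrm{top}}(q)>\log 2$ has an exceptional turning point; that is, there are no isentropes of entropy larger than $\log2$ with exceptional turning points in the space of bimodal maps. (2) In general, for every $l\ge1$ and $s\in\{+1,-1\}$, no map $q\in\mathcal L_{l,s}$ with $\mathrm{h}_{\mathrm{top}}(q)>\log 3$ has an exceptional turning point; that is, there are no exceptional isentropes of topological entropy larger than $\log 3$.
   Context: Fix an integer $l\ge1$ and $s\in\{+1,-1\}$. Put $\beta_0=0$ if $s=+1$, $\beta_0=1$ if $s=-1$; $\beta_1=1$ if $(-1)^ls=+1$, $\beta_1=0$ otherwise. $\mathcal L_{l,s}$ (denoted $\mathcal L_{1,\mathrm{id},l,s}$ in full) is the space of $(h,b^0,\dots,b^l)$ with $h>0$ such that, with $\lambda=e^h$ and $c^i=\frac12(-1)^is\lambda^{-1}(b^{i-1}-b^i)$ for $1\le i\le l$: $b^0=\beta_0$, $(-1)^ls\lambda+b^l=\beta_1$, $0\le c^1\le\dots\le c^l\le1$, and $0\le\frac12(b^{i-1}+b^i)\le1$ for $1\le i\le l$. Such data are identified with the piecewise linear map $q:[0,1]\to[0,1]$, $q(x)=(-1)^is\lambda x+b^i$ on $[c^i,c^{i+1}]$, $0\le i\le l$ (with $c^0=0$, $c^{l+1}=1$); then $\mathrm{h}_{\mathrm{top}}(q)=h$ and $q(c^i)=\frac12(b^{i-1}+b^i)$. The $c^i$, $1\le i\le l$, are the turning points of $q$ (they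 may collide); they partition $[0,1]$ into (relatively) open intervals $J^0,\dots,J^l$. The isentrope of entropy $h$ is the set of maps in $\mathcal L_{l,s}$ of entropy $h$. Bifurcation polynomials. Let $c^{i_0}$ be a turning point of $q\in\mathcal L_{l,s}$ such that $q^n(c^{i_0})$ is a turning point $c^{i_1}$, with $n\ge1$ minimal, and let $q^k(c^{i_0})\in J^{m_k}$ for $1\le k\le n-1$. Regard $\lambda$ and $b^1,\dots,b^{l-1}$ as variables, with $b^0=\beta_0$, $b^l=\beta_1-(-1)^ls\lambda$. Define $V_1=\frac12(b^{i_0-1}+b^{i_0})$ and $V_{k+1}=(-1)^{m_k}s\lambda V_k+b^{m_k}$ for $1\le k\le n-1$. The equation $V_n=\frac12(-1)^{i_1}s\lambda^{-1}(b^{i_1-1}-b^{i_1})$ (which expresses $q^n(c^{i_0})=c^{i_1}$), multiplied by $2\lambda$, takes the form $\sum_{i=1}^{l-1}Q_i(\lambda)b^i=Q_0(\lambda)$ with polynomials $Q_0,\dots,Q_{l-1}$ with rational coefficients, called the bifurcation polynomials of (the itinerary of) $c^{i_0}$. A turning point $c^{i_0}$ of $q$ for which some positive iterate $q^n(c^{i_0})$ is a turning point ($n$ minimal) is called exceptional if $Q_i(e^{\mathrm{h}_{\mathrm{top}}(q)})=0$ for all $i=0,\dots,l-1$. An isentrope is exceptional if it contains a map with an exceptional turning point. *)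

(* Defs.v *)
From mathcomp Require Import all_boot all_order all_algebra.
From mathcomp Require Import all_classical all_reals all_analysis.
Import Order.TTheory GRing.Theory Num.Theory.
Import numFieldNormedType.Exports.

Set Implicit Arguments.
Unset Strict Implicit.
Unset Printing Implicit Defensive.

Local Open Scope classical_set_scope.
Local Open Scope ring_scope.

(* Topological entropy of a self-map of [0,1] (Bowen's definition), counting   *)
(* (n, e)-separated subsets; as the growth rate is nonincreasing in e, its     *)
(* limit for e -> 0 is the supremum over e > 0.                                *)

Definition nseparated (R : realType) (f : R -> R) (n : nat) (e : R)
    (E : seq R) : Prop :=
  [/\ uniq E,
      (forall x, x \in E -> 0 <= x <= 1)
    & forall x y, x \in E -> y \in E -> x != y ->
        exists2 k, (k < n)%N & e < `|iter k f x - iter k f y|].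

Definition sepnum (R : realType) (f : R -> R) (n : nat) (e : R) : \bar R :=
  ereal_sup [set (size E)%:R%:E | E in [set E | nseparated f n e E]].

Definition htop (R : realType) (f : R -> R) : \bar R :=
  ereal_sup [set limn_esup (fun n => (n%:R^-1)%:E * lne (sepnum f n e))%E
            | e in [set e : R | 0 < e]].

Definition beta0 (s : int) : int := if s == 1 then 0 else 1.

Definition beta1 (l : nat) (s : int) : int :=
  if (-1) ^+ l * s == 1 then 1 else 0.

Record pldata (R : realType) (l : nat) := PLData {
  plh : R;
  plb : {ffun 'I_l.+1 -> R}
}.

Section PiecewiseLinear.
Variables (R : realType) (l : nat) (s : int).
Implicit Type q : pldata R l.

Definition lam q : R := expR (plh q).

(* Meaningful for i <= l only. *)
Definition bco q (i : nat) : R := plb q (inord i).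

(* c^0 = 0, c^(l+1) = 1, and the turning points are c^1, ..., c^l. *)
Definition cpt q (i : nat) : R :=
  if i == 0%N then 0
  else if (i <= l)%N then
    2^-1 * (-1) ^+ i * s%:~R * (lam q)^-1 * (bco q i.-1 - bco q i)
  else 1.

Definition plspace : set (pldata R l) := [set q |
  [/\ 0 < plh q,
      bco q 0%N = (beta0 s)%:~R,
      (-1) ^+ l * s%:~R * lam q + bco q l = (beta1 l s)%:~R,
      forall i, (i <= l)%N -> cpt q i <= cpt q i.+1
    & forall i, (1 <= i <= l)%N -> 0 <= 2^-1 * (bco q i.-1 + bco q i) <= 1]].

(* For q in plspace the intervals [c^i, c^(i+1)] cover [0,1] and the branches   *)
(* agree where these intervals meet, so the interval picked for x in [0,1] is  *)
(* immaterial.                                                                 *)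
Definition plmap q (x : R) : R :=
  let i := odflt ord0 [pick i : 'I_l.+1 | cpt q i <= x <= cpt q i.+1] in
  (-1) ^+ i * s%:~R * lam q * x + plb q i.

Definition turning_index (i : nat) : Prop := (1 <= i <= l)%N.

Definition turning_point q (x : R) : Prop :=
  exists2 i, turning_index i & x = cpt q i.

(* The laps J^m are open relatively to [0,1], so J^0 contains 0 if 0 < c^1 and *)
(* J^l contains 1 if c^l < 1.                                                  *)
Definition lap q (m : 'I_l.+1) : set R := [set x |
  [/\ 0 <= x <= 1, (0 < m)%N -> cpt q m < x & (m < l)%N -> x < cpt q m.+1]].

Definition first_hit q (i0 n i1 : nat) : Prop :=
  [/\ (1 <= n)%N, turning_index i1,
      iter n (plmap q) (cpt q i0) = cpt q i1
    & forall k, (1 <= k < n)%N -> ~ turning_point q (iter k (plmap q) (cpt q i0))].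

(* ms = m_1, ..., m_(n-1). *)
Definition itinerary q (i0 n : nat) (ms : seq 'I_l.+1) : Prop :=
  size ms = n.-1 /\
  forall k, (1 <= k < n)%N ->
    lap q (nth ord0 ms k.-1) (iter k (plmap q) (cpt q i0)).

End PiecewiseLinear.

Section BifurcationPolynomials.
Variables (l : nat) (s : int).

(* The row v stands for v_0 + v_1 b^1 + ... + v_(l-1) b^(l-1), an affine form  *)
(* in the variables b^i whose coefficients are polynomials in lambda = 'X.     *)
Definition aform := 'rV[{poly rat}]_l.

Definition aconst (p : {poly rat}) : aform :=
  \row_(j < l) (if val j == 0%N then p else 0).

Definition avar (i : nat) : aform :=
  \row_(j < l) (if val j == i then 1 else 0).

Definition bform (i : nat) : aform :=
  if i == 0%N then aconst (beta0 s)%:~R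
  else if i == l then aconst ((beta1 l s)%:~R - (-1) ^+ l * s%:~R * 'X)
  else avar i.

Definition Vform (i0 : nat) (ms : seq 'I_l.+1) : aform :=
  foldl (fun V m => ((-1) ^+ val m * s%:~R * 'X) *: V + bform (val m))
        ((2^-1)%:P *: (bform i0.-1 + bform i0)) ms.

(* 2 lambda V_n - (-1)^(i1) s (b^(i1-1) - b^(i1)) *)
Definition eqform (i0 i1 : nat) (ms : seq 'I_l.+1) : aform :=
  (2 * 'X) *: Vform i0 ms
  - ((-1) ^+ i1 * s%:~R) *: (bform i1.-1 - bform i1).

(* The polynomials in the equation Q_1 b^1 + ... + Q_(l-1) b^(l-1) = Q_0,      *)
(* whence the opposite sign of the constant term.                              *)
Definition bifpoly (i0 i1 : nat) (ms : seq 'I_l.+1) (i : 'I_l) : {poly rat} :=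
  if val i == 0%N then - eqform i0 i1 ms 0 i else eqform i0 i1 ms 0 i.

End BifurcationPolynomials.

(* When turning points collide, the index i1 of the turning point that is hit  *)
(* need not be unique; any admissible choice makes the turning point           *)
(* exceptional.                                                                *)
Definition exceptional (R : realType) (l : nat) (s : int) (q : pldata R l)
    (i0 : nat) : Prop :=
  turning_index l i0 /\
  exists n i1 ms,
    [/\ first_hit s q i0 n i1, itinerary s q i0 n ms
      & forall i : 'I_l,
          (map_poly ratr (bifpoly s i0 i1 ms i)).[expR (fine (htop (plmap s q)))]
          = 0].

Definition isentrope (R : realType) (l : nat) (s : int) (h : R) :
    set (pldata R l) :=
  [set q | plspace s q /\ htop (plmap s q) = h%:E].

Definition exceptional_isentrope (R : realType) (l : nat) (s : int) (h : R) :
    Prop :=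
  exists2 q : pldata R l, isentrope s h q & exists i0, exceptional s q i0.

(* Main.v *)
(* If c^{i0} is exceptional, the coefficient v of b^j in V_n vanishes, up to the
   small contribution of the target, at lambda = mu := exp(h_top); take
   j = i0 - 1 or j = i0 with 0 < j < l, so that v starts from 1/2. One step
   replaces v by +-mu v or by +-mu v + 1: for mu >= 3 the bound |v| >= 1/2
   persists, and for mu > 2 so does |v| >= 1. In the bimodal case v can thus
   only vanish if the first step subtracts, i.e. if s = 1 and q(c^{i0}) lies in
   the middle lap. But then the slope lambda > 2 sends q^2(c^{i0}) out of [0,1].
   The slope dominates mu because q is lambda-Lipschitz, so that
   h_top(q) <= log lambda; this also settles l = 1, where lambda <= 2. *)

Require Import Defs.
From mathcomp Require Import all_boot all_order all_algebra.
From mathcomp Require Import all_classical all_reals all_analysis.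
From mathcomp Require Import ring lra zify.
Import Order.TTheory GRing.Theory Num.Theory.
Import numFieldNormedType.Exports.

Set Implicit Arguments.
Unset Strict Implicit.
Unset Printing Implicit Defensive.

Local Open Scope classical_set_scope.
Local Open Scope ring_scope.

(** * Entropy of Lipschitz self-maps of the unit interval *)

Section LipschitzEntropy.
Variables (R : realType) (f : R -> R) (h : R).
Hypothesis h_ge0 : 0 <= h.
Hypothesis f01 : forall x, 0 <= x <= 1 -> 0 <= f x <= 1.
Hypothesis f_lip : forall x y, 0 <= x <= 1 -> 0 <= y <= 1 ->
  `|f x - f y| <= expR h * `|x - y|.

Lemma iter01 n x : 0 <= x <= 1 -> 0 <= iter n f x <= 1.
Proof. by move=> x01; elim: n => //= n; exact: f01. Qed.

Lemma iter_lip n x y : 0 <= x <= 1 -> 0 <= y <= 1 ->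
  `|iter n f x - iter n f y| <= expR h ^+ n * `|x - y|.
Proof.
move=> x01 y01; elim: n => [|n IHn] /=; first by rewrite expr0 mul1r.
apply: le_trans (f_lip (iter01 n x01) (iter01 n y01)) _.
by rewrite exprS -mulrA ler_wpM2l ?expR_ge0.
Qed.

(** Pigeonhole: [g] numbers cells of length [r^-1]. Points of one cell stay within [e] for the first
    [n] iterates, so [E] meets each cell at most once. *)
Lemma nseparated_size n e E : 0 < e -> nseparated f n e E ->
  (size E)%:R <= e^-1 * expR h ^+ n + 1.
Proof.
move=> e0 [uE E01 Esep].
have L1 : 1 <= expR h by rewrite -expR0 ler_expR.
set r := e^-1 * expR h ^+ n.
have r0 : 0 < r by rewrite mulr_gt0 ?invr_gt0 ?exprn_gt0 ?expR_gt0.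
pose g x := Num.truncn (x * r).
have g_inj : {in E &, injective g}.
  move=> x y xE yE gxy; apply/eqP/negPn/negP => xy.
  have [k kn ek] := Esep x y xE yE xy.
  have /andP[x0 _] := E01 _ xE; have /andP[y0 _] := E01 _ yE.
  have /truncn_itv/andP[] : 0 <= x * r by rewrite mulr_ge0// ltW.
  have /truncn_itv/andP[] : 0 <= y * r by rewrite mulr_ge0// ltW.
  rewrite -/(g x) -/(g y) gxy -!natr1 => y1 y2 x1 x2.
  have : `|x * r - y * r| < 1 by rewrite ltr_norml; apply/andP; split; lra.
  rewrite -mulrBl normrM (gtr0_norm r0) /r mulrCA mulrC -ltr_pdivlMr ?invr_gt0//.
  rewrite invrK mul1r; apply/negP; rewrite -leNgt.
  apply: (le_trans (ltW ek)).
  apply: (le_trans (iter_lip k (E01 _ xE) (E01 _ yE))).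
  by rewrite mulrC ler_wpM2l// ler_weXn2l// ltnW.
have : (size (map g E) <= size (iota 0 (Num.truncn r).+1))%N.
  apply: uniq_leq_size; first by rewrite map_inj_in_uniq.
  move=> _ /mapP[x xE ->]; rewrite mem_iota add0n /= ltnS.
  have /andP[x0 x1] := E01 _ xE.
  by apply: le_truncn; rewrite ler_piMl// ltW.
rewrite size_map size_iota -(ler_nat R) -natr1 => /le_trans; apply.
by rewrite lerD2r; have /truncn_itv/andP[] := ltW r0.
Qed.

Lemma htop_lip : (htop f <= h%:E)%E.
Proof.
apply: ge_ereal_sup => _ [e /= e0 <-].
(* [C] absorbs the summand 1 of the size bound, as [1 <= expR h ^+ n]. *)
pose C := e^-1 + 1.
have C1 : 1 <= C by rewrite lerDr invr_ge0 ltW.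
have lnC : 0 <= ln C by rewrite ln_ge0.
have sep n : (sepnum f n e <= (C * expR h ^+ n)%:E)%E.
  apply: ge_ereal_sup => _ [E /= /(nseparated_size e0) sE <-].
  rewrite lee_fin (le_trans sE)// mulrDl mul1r lerD2l exprn_ege1//.
  by rewrite -expR0 ler_expR.
have sep0 n : (0 <= sepnum f n e)%E.
  by apply: ereal_sup_ubound; exists [::] => //; split.
apply/lee_addgt0Pr => d d0; rewrite /limn_esup limf_esupE.
apply: ge_ereal_inf => /=.
(* On this tail [ln C / n <= d], so the growth rate is at most [h + d]. *)
exists (ereal_sup [set (n%:R^-1%:E * lne (sepnum f n e))%E
                  | n in [set n | (Num.truncn (ln C / d) < n)%N]]).
  by exists [set n | (Num.truncn (ln C / d) < n)%N] => //; exact: nbhs_infty_gt.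
apply: ge_ereal_sup => _ [n /= nC <-].
have n0 : 0 < n%:R :> R by rewrite ltr0n (leq_ltn_trans _ nC).
have C0 : 0 < C by apply: lt_le_trans C1.
have Cn : (lne (sepnum f n e) <= (ln C + n%:R * h)%:E)%E.
  have -> : (ln C + n%:R * h)%:E = lne (C * expR h ^+ n)%:E.
    rewrite lne_EFin ?mulr_gt0 ?exprn_gt0 ?expR_gt0//.
    by rewrite lnM ?posrE ?exprn_gt0 ?expR_gt0// -expRM_natl expRK.
  rewrite lee_lne ?in_itv/= ?leey ?andbT ?sep//.
  by rewrite lee_fin mulr_ge0 ?exprn_ge0 ?expR_ge0// ltW.
apply: (le_trans (lee_wpmul2l _ Cn)); first by rewrite lee_fin invr_ge0 ltW.
rewrite -EFinM -EFinD lee_fin mulrDr mulKf ?gt_eqF// addrC lerD2l.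
rewrite mulrC ler_pdivrMr// -ler_pdivrMl// mulrC.
have lt0 : 0 <= ln C / d by rewrite divr_ge0// ltW.
by rewrite ltW// -truncn_lt_nat.
Qed.

End LipschitzEntropy.

(** * Growth of the coefficients of the affine forms *)

Section Coefficients.
Variables (R : realType) (l : nat) (s : int) (mu : R).
Hypothesis s_unit : s = 1 \/ s = -1.

(** Meant for [0 < j < l], where [b^j] is a genuine variable. *)
Definition bcoef_step (j m : nat) (v : R) : R :=
  (-1) ^+ m * s%:~R * mu * v + (m == j)%:R.

(* The coefficient of b^j in V_n at lambda = mu, when j is i0 - 1 or i0. *)
Definition bcoef (j : nat) (ms : seq 'I_l.+1) : R :=
  foldl (fun v m => bcoef_step j (val m) v) 2^-1 ms.

Let norm_sgn m : `|(-1) ^+ m * s%:~R| = 1 :> R.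
Proof.
by rewrite normrM normr_sign mul1r; case: s_unit => ->; rewrite ?normrN ?normr1.
Qed.

(** [b^0] and [b^l] are constants, stored in column 0; no [j] with [0 < j < l] equals 0 or [l]. *)
Lemma bform_coef i (j : 'I_l) : (0 < j)%N ->
  bform l s i 0 j = (i == j :> nat)%:R.
Proof.
move=> j0; rewrite /bform /aconst /avar; case: eqP => [->|i0].
  by rewrite mxE gtn_eqF // ltn_eqF.
case: eqP => [->|il]; rewrite mxE; last by rewrite eq_sym; case: ifP.
by rewrite !gtn_eqF.
Qed.

(** At a root, [2 mu v] equals the coefficient of [b^j] in the target term, which is -1, 0 or 1. *)
Lemma bifpoly_root_bcoef (j : 'I_l) i0 i1 ms :
  (0 < j)%N -> (1 <= i0)%N -> i0.-1 = j \/ i0 = j ->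
  (map_poly ratr (bifpoly s i0 i1 ms j)).[mu] = 0 ->
  `|2 * mu * bcoef j ms| <= 1.
Proof.
move=> j0 i00 i0j.
pose ev : {rmorphism {poly rat} -> R} := horner_eval mu \o map_poly ratr.
have evX : ev 'X = mu by rewrite /= /horner_eval map_polyX hornerX.
have evC c : ev c%:P = ratr c.
  by rewrite /= /horner_eval map_polyC hornerC.
have V_coef (V : aform l) :
  ev (foldl (fun V m => ((-1) ^+ val m * s%:~R * 'X) *: V + bform l s (val m))
        V ms 0 j) = foldl (fun v m => bcoef_step j (val m) v) (ev (V 0 j)) ms.
  elim: ms V => // m ms IH V; apply: etrans (IH _) _; congr (foldl _ _ ms).
  by rewrite !mxE bform_coef// rmorphD !rmorphM rmorph_sign rmorph_int
    rmorph_nat evX.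
rewrite -[_.[mu]]/(ev _) /bifpoly /eqform gtn_eqF// !mxE !bform_coef//.
rewrite rmorphB !rmorphM rmorphB.
rewrite rmorph_sign rmorph_int !rmorph_nat evX /Vform V_coef.
rewrite !mxE !bform_coef// rmorphM evC rmorphD !rmorph_nat fmorphV rmorph_nat.
have -> : 2^-1 * ((i0.-1 == j)%:R + (i0 == j)%:R) = 2^-1 :> R.
  case: i0j => i0E.
    by rewrite i0E eqxx (_ : i0 == j = false) ?addr0 ?mulr1//; lia.
  by rewrite i0E eqxx (_ : j.-1 == j = false) ?add0r ?mulr1//; lia.
move/eqP; rewrite subr_eq0 => /eqP ->.
rewrite normrM norm_sgn mul1r.
by case: eqP; case: eqP; rewrite ?subr0 ?subrr ?sub0r ?normrN ?normr1 ?normr0.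
Qed.

Lemma bcoef_step_norm j m v : `|mu| * `|v| - 1 <= `|bcoef_step j m v|.
Proof.
rewrite /bcoef_step; apply: le_trans (lerB_normD _ _).
rewrite !normrM -normrM norm_sgn mul1r lerD2l lerN2.
by case: eqP; rewrite ?normr1 ?normr0.
Qed.

(** The region [|v| >= k] is invariant under each step, since [mu k - 1 >= k]. *)
Lemma bcoef_norm (k : R) j (ms : seq 'I_l.+1) v : 0 <= k ->
  k + 1 <= mu * k -> k <= `|v| ->
  k <= `|foldl (fun v m => bcoef_step j (val m) v) v ms|.
Proof.
move=> k0 muk; elim: ms v => //= m ms IH v kv; apply: IH.
apply: le_trans (bcoef_step_norm j m v).
have mu0 : 0 <= `|mu| by [].
have := ler_norm mu; nra.
Qed.

Lemma bifpoly_root_lt3 (j : 'I_l) i0 i1 ms :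
  (0 < j)%N -> (1 <= i0)%N -> i0.-1 = j \/ i0 = j ->
  (map_poly ratr (bifpoly s i0 i1 ms j)).[mu] = 0 ->
  mu < 3.
Proof.
move=> j0 i00 i0j root; rewrite ltNge; apply/negP => mu3.
have := bifpoly_root_bcoef j0 i00 i0j root.
have : 2^-1 <= `|bcoef j ms|.
  by apply: bcoef_norm; [lra | nra | rewrite ger0_norm; lra].
by rewrite !normrM ger0_norm// [`|mu|]ger0_norm; nra.
Qed.

(** The first step turns 1/2 into [mu/2], [-mu/2], [mu/2 + 1] or [1 - mu/2]. All but the last have
    modulus above 1, which then persists; the last needs [m_1 = j] and a decreasing lap. *)
Lemma bifpoly_root_first (j : 'I_l) i0 i1 ms :
  (0 < j)%N -> (1 <= i0)%N -> i0.-1 = j \/ i0 = j -> 2 < mu ->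
  (map_poly ratr (bifpoly s i0 i1 ms j)).[mu] = 0 ->
  [/\ ms != [::], head ord0 ms = j :> nat & (-1) ^+ j * s = -1].
Proof.
move=> j0 i00 i0j mu2 root.
have := bifpoly_root_bcoef j0 i00 i0j root.
rewrite /bcoef; case: ms {root} => [|m ms] /=.
  by rewrite ger0_norm; nra.
move=> le1; suff : (m == j :> nat) && ((-1) ^+ j * s == -1).
  by move=> /andP[/eqP ? /eqP].
apply: contraLR le1 => mj; rewrite -ltNge.
suff step1 : 1 <= `|bcoef_step j m 2^-1|.
  have := bcoef_norm j ms ler01 _ step1.
  by rewrite !normrM ger0_norm// [`|mu|]ger0_norm; nra.
move: mj; rewrite negb_and /bcoef_step; case: eqP => /= [->|_ _].
  have -> : (-1) ^+ j * s%:~R = ((-1) ^+ j * s)%:~R :> R.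
    by rewrite rmorphM rmorph_sign.
  have [->|->//] : (-1) ^+ j * s = 1 \/ (-1) ^+ j * s = -1.
    by rewrite -signr_odd; case: s_unit => ->; case: (odd j);
      [right|left|left|right].
  by move=> _; rewrite ger0_norm; lra.
rewrite addr0 !normrM -normrM norm_sgn mul1r !ger0_norm; lra.
Qed.

End Coefficients.

(** * The piecewise linear map: well-definedness, range and Lipschitz constant *)

Section PiecewiseLinearMap.
Variables (R : realType) (l : nat) (s : int) (q : pldata R l).
Hypothesis s_unit : s = 1 \/ s = -1.
Hypothesis q_pl : plspace s q.

Let lam_gt0 : 0 < lam q. Proof. exact: expR_gt0. Qed.

Definition branch (i : nat) (x : R) : R :=
  (-1) ^+ i * s%:~R * lam q * x + bco q i.

Let sgnP i : (-1) ^+ i * s%:~R = 1 :> R \/ (-1) ^+ i * s%:~R = -1 :> R.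
Proof.
rewrite -signr_odd; case: s_unit => ->; case: (odd i) => /=;
  rewrite ?expr0 ?expr1 ?mulrN ?mulr1 ?opprK; by [left|right].
Qed.

Lemma cptS i : (i < l)%N ->
  cpt s q i.+1 =
  - (2^-1 * ((-1) ^+ i * s%:~R) * (lam q)^-1 * (bco q i - bco q i.+1)).
Proof. by move=> il; rewrite /cpt il /= exprS; ring. Qed.

Lemma branch_cpt_right i : (i < l)%N ->
  branch i (cpt s q i.+1) = 2^-1 * (bco q i + bco q i.+1).
Proof.
move=> il; rewrite cptS// /branch.
by case: (sgnP i) => ->; field; rewrite ?gt_eqF.
Qed.

Lemma branch_cpt_left i : (i < l)%N ->
  branch i.+1 (cpt s q i.+1) = 2^-1 * (bco q i + bco q i.+1).
Proof.
move=> il; rewrite cptS// /branch exprS mulN1r mulNr.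
by case: (sgnP i) => ->; field; rewrite ?gt_eqF.
Qed.

(** By affinity the endpoints suffice: the values are 0 or 1 at the ends of [0,1], and the bounded
    midpoints at turning points. *)
Lemma branch01 i x : (i <= l)%N -> cpt s q i <= x <= cpt s q i.+1 ->
  0 <= branch i x <= 1.
Proof.
move=> il xi; have [_ b0 bl cle mid] := q_pl.
have left01 : 0 <= branch i (cpt s q i) <= 1.
  case: i il xi => [_ _|i il _]; last by rewrite branch_cpt_left// (mid i.+1).
  by rewrite /branch /cpt /= mulr0 add0r b0 /beta0; case: ifP; rewrite ?ler01 ?lexx.
have right01 : 0 <= branch i (cpt s q i.+1) <= 1.
  move: il; rewrite leq_eqVlt => /predU1P[iE|il]; last first.
    by rewrite branch_cpt_right// (mid i.+1).
  rewrite iE /branch /cpt /= ltnn mulr1 bl /beta1.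
  by case: ifP; rewrite ?ler01 ?lexx.
move: left01 right01; rewrite /branch.
have := lam_gt0; move: (lam q) => L L0.
case: (sgnP i) => ->; rewrite ?mul1r ?mulN1r; nra.
Qed.

(** Induction on [j - i]: split [y - x] at [c^(i+1)], where branches [i] and [i+1] agree. *)
Lemma branch_lip i j x y : (i <= j)%N -> (j <= l)%N ->
  cpt s q i <= x <= cpt s q i.+1 -> cpt s q j <= y <= cpt s q j.+1 ->
  `|branch i x - branch j y| <= lam q * `|x - y|.
Proof.
have lip k u v : `|branch k u - branch k v| = lam q * `|u - v|.
  rewrite /branch opprD addrACA subrr addr0 -mulrBr normrM.
  by case: (sgnP k) => ->; rewrite ?mulN1r ?mul1r ?normrN (gtr0_norm lam_gt0).
have [_ _ _ cle _] := q_pl.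
have cmono k m : (k <= m)%N -> (m <= l.+1)%N -> cpt s q k <= cpt s q m.
  elim: m => [|m IH]; first by rewrite leqn0 => /eqP ->.
  rewrite leq_eqVlt => /predU1P[->//|km] ml.
  by apply: le_trans (cle m ml); apply: IH => //; exact: ltnW.
move=> ij; have [k] := ubnP (j - i); elim: k i x ij => // k IH i x ij kij jl xi yj.
move: ij; rewrite leq_eqVlt => /predU1P[<-|ij]; first by rewrite lip.
have il : (i < l)%N by apply: leq_trans jl.
have cy : cpt s q i.+1 <= y.
  by case/andP: yj => yj _; apply: le_trans yj; apply: cmono => //; exact: leqW.
have /andP[_ xc] := xi.
rewrite (distrC x) [`|y - x|]ger0_norm ?subr_ge0 ?(le_trans xc)//.
have -> : y - x = (cpt s q i.+1 - x) + (y - cpt s q i.+1) by ring.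
rewrite mulrDr -{1}(ger0_norm (x := _ - x)) ?subr_ge0//.
rewrite -(ger0_norm (x := y - _)) ?subr_ge0// (distrC _ x) (distrC y) -(lip i).
apply: le_trans (ler_distD (branch i (cpt s q i.+1)) _ _) _; rewrite lerD2l.
rewrite branch_cpt_right// -branch_cpt_left//; apply: IH => //; first lia.
by rewrite lexx cle.
Qed.

(** Two branches available at [x] agree, by [branch_lip] with both points equal to [x]. *)
Lemma plmap_branch i x : (i <= l)%N -> cpt s q i <= x <= cpt s q i.+1 ->
  plmap s q x = branch i x.
Proof.
move=> il xi; rewrite /plmap; case: pickP => [/= j xj|/(_ (inord i))]; last first.
  by rewrite inordK// xi.
rewrite -[plb q j]/(plb q j) -{2}(inord_val j) -/(bco q j) -/(branch j x).
apply/eqP; rewrite -subr_eq0 -normr_le0.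
have -> : 0 = lam q * `|x - x| by rewrite subrr normr0 mulr0.
have [ij|/ltnW ji] := leqP i j; last exact: (branch_lip ji).
by rewrite distrC; apply: (branch_lip ij) => //; rewrite -ltnS.
Qed.

Lemma cpt_cover x : 0 <= x <= 1 ->
  exists2 i, (i <= l)%N & cpt s q i <= x <= cpt s q i.+1.
Proof.
move=> /andP[x0 x1].
have x_last : x <= cpt s q l.+1 by rewrite /cpt ltnn.
have ex : exists i, x <= cpt s q i.+1 by exists l.
(* Minimality of the index gives the lower bound on [x]. *)
case: (ex_minnP ex) => -[|i] xi imin.
  by exists 0%N => //; rewrite xi andbT /cpt.
exists i.+1; first exact: imin.
rewrite xi andbT leNgt; apply/negP => /ltW /imin; lia.
Qed.

Lemma plmap01 x : 0 <= x <= 1 -> 0 <= plmap s q x <= 1.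
Proof. by move=> /cpt_cover[i il xi]; rewrite (plmap_branch il xi) branch01. Qed.

Lemma plmap_lip x y : 0 <= x <= 1 -> 0 <= y <= 1 ->
  `|plmap s q x - plmap s q y| <= lam q * `|x - y|.
Proof.
move=> /cpt_cover[i il xi] /cpt_cover[j jl yj].
rewrite (plmap_branch il xi) (plmap_branch jl yj).
have [ij|/ltnW ji] := leqP i j; first exact: branch_lip.
by rewrite distrC (distrC x); apply: branch_lip.
Qed.

Lemma plmap_cpt i : (1 <= i <= l)%N ->
  plmap s q (cpt s q i) = 2^-1 * (bco q i.-1 + bco q i).
Proof.
case: i => // i /andP[_ il]; have [_ _ _ cle _] := q_pl.
by rewrite (@plmap_branch i.+1) ?lexx ?cle// branch_cpt_left.
Qed.

End PiecewiseLinearMap.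

(** * Comparison of entropy and slope *)

Section Entropy.
Variables (R : realType) (l : nat) (s : int) (q : pldata R l).
Hypothesis s_unit : s = 1 \/ s = -1.
Hypothesis q_pl : plspace s q.

Lemma htop_plmap_le : (htop (plmap s q) <= (plh q)%:E)%E.
Proof.
apply: htop_lip; first by case: q_pl => /ltW.
- by move=> x; exact: plmap01.
- by move=> x y; exact: plmap_lip.
Qed.

(** The entropy is bounded on both sides, hence finite, so [fine] returns its true value. *)
Lemma expR_htop_itv (c : R) : 0 < c -> ((ln c)%:E < htop (plmap s q))%E ->
  c < expR (fine (htop (plmap s q))) <= lam q.
Proof.
move=> c0; have := htop_plmap_le; case: htop => //= r.
rewrite lee_fin lte_fin /lam ler_expR => -> cr.
by rewrite andbT -ltr_ln ?posrE ?expR_gt0// expRK.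
Qed.

End Entropy.

(** The turning value in [0,1] is [lam/2] or [1 - lam/2]. *)
Lemma unimodal_lam_le2 (R : realType) (s : int) (q : pldata R 1) :
  s = 1 \/ s = -1 -> plspace s q -> lam q <= 2.
Proof.
move=> s_unit [_ b0 b1 _ /(_ 1%N isT)] /=.
move: b0 b1; rewrite /beta0 /beta1; case: s_unit => -> /= -> b1 /andP[]; lra.
Qed.

(** Let [b = b^1]. For [c^1], [c^1 < q(c^1)] gives [b > 0], and [q^2(c^1) = -b (lam - 2)/2 < 0]. For
    [c^2], [q(c^2) < c^2] gives [b < 1 + lam], and [q^2(c^2) - 1 = (1 + lam - b) (lam - 2)/2 >
    0]. *)
Lemma bimodal_middle_lap (R : realType) (q : pldata R 2) (i0 : nat) (m : 'I_3) :
  plspace 1 q -> turning_index 2 i0 -> 2 < lam q -> m = 1%N :> nat ->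
  ~ lap 1 q m (plmap 1 q (cpt 1 q i0)).
Proof.
move=> q_pl i0t lam2 m1 [y01]; rewrite m1 => /(_ isT) c1y /(_ isT) yc2.
have s_unit : (1 : int) = 1 \/ (1 : int) = -1 by left.
have := plmap01 s_unit q_pl y01.
rewrite (@plmap_branch _ _ _ _ s_unit q_pl 1) ?(ltW c1y) ?(ltW yc2)//.
move: c1y yc2; rewrite (plmap_cpt s_unit q_pl i0t) !cptS// /branch.
have [_ b0 b2 _ _] := q_pl.
have {}b0 : bco q 0 = 0 by rewrite b0.
have {}b2 : bco q 2 = 1 - lam q.
  by move: b2; rewrite sqrrN expr1n !mul1r => b2; rewrite -[1]b2 addrAC subrr add0r.
have lam0 : 0 < lam q by lra.
have : 0 < (lam q)^-1 < 2^-1 by rewrite invr_gt0 lam0 ltf_pV2 ?posrE.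
have : (lam q)^-1 * lam q = 1 by rewrite mulVf ?gt_eqF.
rewrite expr0 expr1 mul1r mulN1r -[1%:~R]/(1 : R) b0 b2.
case: i0 i0t {y01 m1} => [|[|[|//]]] // _; rewrite [_.-1]/= ?b0 ?b2;
  move: (lam q) (lam q)^-1 (bco q 1) lam2
    => L I b L2 IL /andP[I0 I2] c1y yc2 /andP[y0 y1].
  have : 0 < b * (1 - I) by lra.
  rewrite pmulr_lgt0 => [b_gt0|]; last by lra.
  have : 0 < b * (L - 2) by rewrite mulr_gt0// subr_gt0.
  lra.
have : 0 < (1 + L - b) * (1 - I) by lra.
rewrite pmulr_lgt0 => [bL|]; last by lra.
have : 0 < (1 + L - b) * (L - 2) by rewrite mulr_gt0// subr_gt0.
lra.
Qed.

Theorem theorem6 (R : realType) :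
  (forall s : int, s = 1 \/ s = -1 ->
     (forall q : pldata R 2, plspace s q ->
        ((ln 2)%:E < htop (plmap s q))%E ->
        forall i0 : nat, ~ exceptional s q i0)
     /\ (forall h : R, ln 2 < h -> ~ exceptional_isentrope 2 s h))
  /\
  (forall (l : nat) (s : int), (1 <= l)%N -> s = 1 \/ s = -1 ->
     (forall q : pldata R l, plspace s q ->
        ((ln 3)%:E < htop (plmap s q))%E ->
        forall i0 : nat, ~ exceptional s q i0)
     /\ (forall h : R, ln 3 < h -> ~ exceptional_isentrope l s h)).
Proof.
split=> [s s_unit | l s l1 s_unit].
  suff main (q : pldata R 2) : plspace s q ->
      ((ln 2)%:E < htop (plmap s q))%E -> forall i0 : nat, ~ exceptional s q i0.
    split=> // h h2 [q [q_pl hq] [i0]]; apply: main => //.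
    by rewrite hq lte_fin.
  move=> q_pl /(expR_htop_itv s_unit q_pl)-/(_ ltac:(lra))/andP[mu2 mu_lam] i0.
  case=> i0t [n [i1 [ms [[n1 _ _ _] [ms_size ms_lap] root]]]].
  have /andP[i01 i02] := i0t.
  (* For [l = 2] the only variable is [b^1], adjacent to both turning points. *)
  have i0j : i0.-1 = (ord_max : 'I_2) \/ i0 = (ord_max : 'I_2).
    by case: i0 i01 i02 {i0t ms_lap root} => [|[|[|]]]// _ _; [right | left].
  have [ms0 ms_first s1] :=
    bifpoly_root_first s_unit (isT : 0 < (ord_max : 'I_2))%N i01 i0j mu2
      (root ord_max).
  have {}s1 : s = 1 by case: s_unit s1 => -> //.
  rewrite s1 in q_pl ms_lap.
  apply: (bimodal_middle_lap q_pl i0t (lt_le_trans mu2 mu_lam) ms_first).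
  have := ms_lap 1%N; rewrite /= nth0; apply.
  (* As [ms] has length [n.-1], being nonempty means [1 < n]. *)
  by rewrite ltnNge; apply: contra ms0 => n1'; rewrite -size_eq0 ms_size; lia.
suff main (q : pldata R l) : plspace s q ->
    ((ln 3)%:E < htop (plmap s q))%E -> forall i0 : nat, ~ exceptional s q i0.
  split=> // h h3 [q [q_pl hq] [i0]]; apply: main => //.
  by rewrite hq lte_fin.
move=> q_pl /(expR_htop_itv s_unit q_pl)-/(_ ltac:(lra))/andP[mu3 mu_lam] i0.
(* For [l = 1] there is no variable [b^j]; the slope bound excludes this case. *)
have [l2|l_le1] := ltnP 1 l; last first.
  have l1E : l = 1%N by lia.
  subst l; have := unimodal_lam_le2 s_unit q_pl; lra.
case=> /andP[i01 i0l] [n [i1 [ms [_ _ root]]]].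
have [j j0 i0j] : exists2 j : 'I_l, (0 < j)%N & i0.-1 = j \/ i0 = j.
  have [i02|i0_le1] := ltnP 1 i0.
    have jl : (i0.-1 < l)%N by lia.
    by exists (Ordinal jl); [rewrite /=; lia | left].
  have jl : (i0 < l)%N by lia.
  by exists (Ordinal jl); [| right].
have := bifpoly_root_lt3 s_unit j0 i01 i0j (root j); lra.
Qed.
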